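(* Let $F,G:\mathbb R^d\to\mathbb R^d$ be invertible linear maps, each with $d$ distinct real eigenvalues, $\lambda_1,\dots,\lambda_d$ for $F$ and $t_1,\dots,t_d$ for $G$, with corresponding normalised eigenvectors $\hat e_1,\dots,\hat e_d$ and $\tilde e_1,\dots,\tilde e_d$. Assume that for every $k=1,\dots,d$ the products $\lambda_{i_1}\cdots\lambda_{i_k}$ over distinct $k$-element index sets $\{i_1<\dots<i_k\}\subset\{1,\dots,d\}$ are pairwise different, and likewise for the products $t_{i_1}\cdots t_{i_k}$. Let $A$ be the matrix defined by $\hat e_i=\sum_jA_{ji}\tilde e_j$ and assume $A\in\mathcal M_d$. Let $n_0=\max_{0\le m\le d}\binom dm$. Then the family $\mathcal S_{2n_0^2}(F,G)$ satisfies condition $C(s)$ for all $0\le s\le d$.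
   Context: $\mathcal M_d$ is the class of $d\times d$ matrices all of whose minors (of all sizes) are nonzero. For $k\in\mathbb N$, $\mathcal S_k(F,G)=\{T_1\circ\dots\circ T_j\mid 1\le j\le k,\ T_i\in\{F,G\}\}$. $\Lambda^m$ is the $m$-th exterior power of $\mathbb R^d$ ($\Lambda^0=\mathbb R$) with the standard inner product for which $\{e_{i_1}\wedge\dots\wedge e_{i_m}\mid i_1<\dots<i_m\}$ is orthonormal whenever $\{e_j\}$ is an orthonormal basis; $\Lambda_0^m$ is the set of decomposable $m$-vectors $v_1\wedge\dots\wedge v_m$; linear maps act on $\Lambda^m$ by $S(v_1\wedge\dots\wedge v_m)=Sv_1\wedge\dots\wedge Sv_m$. A family $\{S_i\}_{i\in I}$ satisfies condition $C(m)$ (integer $0\le m\le d$) if for all nonzero $\mathbf v,\mathbf w\in\Lambda_0^m$ there is $i$ with $\langle S_i\mathbf v\mid\mathbf w\rangle\ne0$. For non-integral $0<s<d$ with integer part $m$, it satisfies $C(s)$ if for all nonzero $\mathbf v,\mathbf w\in\Lambda_0^m$ and all $v,w\in\mathbb R^d$ with $\mathbf v\wedge v\ne0$, $\mathbf w\wedge w\ne0$, there is $i$ with $\langle S_i\mathbf v\mid\mathbf w\rangle\ne0$ and $\langle S_i(\mathbf v\wedge v)\mid\mathbf w\wedge w\rangle\ne0$. *)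

(* Defs.v *)
From HB Require Import structures.
From mathcomp Require Import all_boot all_order all_algebra.
Set Implicit Arguments. Unset Strict Implicit. Unset Printing Implicit Defensive.
Import Order.TTheory GRing.Theory Num.Theory.
Local Open Scope ring_scope.

(* Vectors of R^d are column vectors 'cV[R]_d; linear maps are matrices
   'M[R]_d acting by left multiplication.  The standard basis of R^d is
   orthonormal. *)

(* selection matrix of the index set I (listed increasingly by enum I):
   column j is the standard basis vector e_{i_j}.  Only meaningful when #|I| = m. *)
Definition selmx (R : pzRingType) (d m : nat) (I : {set 'I_d}) : 'M[R]_(d, m) :=
  \matrix_(k < d, j < m) ((nth k (enum I) j == k)%:R).

(* The m-th exterior power Lambda^m, in coordinates w.r.t. the orthonormal
   basis e_I = e_{i_1} /\ ... /\ e_{i_m} (i_1 < ... < i_m), is represented as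
   a function {set 'I_d} -> R supported on sets of cardinality m.
   wedge V = v_1 /\ ... /\ v_m, where v_1..v_m are the columns of V;
   its e_I coordinate is the minor of V on the rows I. *)
Definition wedge (R : comPzRingType) (d m : nat) (V : 'M[R]_(d, m))
  : {ffun {set 'I_d} -> R} :=
  [ffun I : {set 'I_d} => if #|I| == m then \det ((selmx R m I)^T *m V) else 0].

(* standard inner product (the e_I are orthonormal) *)
Definition ip (R : comPzRingType) (d : nat) (x y : {ffun {set 'I_d} -> R}) : R :=
  \sum_(I : {set 'I_d}) x I * y I.

(* Decomposable m-vectors are exactly the wedge V, V : 'M_(d,m); a linear map S
   acts by S (v_1 /\ ... /\ v_m) = S v_1 /\ ... /\ S v_m, i.e. wedge (S *m V). *)

Definition condC_int (R : comPzRingType) (d : nat) (P : 'M[R]_d -> Prop) (m : nat) :=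
  forall V W : 'M[R]_(d, m), wedge V != 0 -> wedge W != 0 ->
    exists S, P S /\ ip (wedge (S *m V)) (wedge W) != 0.

Definition condC_frac (R : comPzRingType) (d : nat) (P : 'M[R]_d -> Prop) (m : nat) :=
  forall (V W : 'M[R]_(d, m)) (v w : 'cV[R]_d),
    wedge V != 0 -> wedge W != 0 ->
    wedge (row_mx V v) != 0 -> wedge (row_mx W w) != 0 ->
    exists S, P S /\ ip (wedge (S *m V)) (wedge W) != 0
                  /\ ip (wedge (S *m row_mx V v)) (wedge (row_mx W w)) != 0.

Definition condC (R : realFieldType) (d : nat) (P : 'M[R]_d -> Prop) (s : R) :=
  (forall m : nat, s = m%:R -> condC_int P m) /\
  (forall m : nat, m%:R < s < m.+1%:R -> condC_frac P m).

Definition wordmx (R : pzRingType) (d : nat) (F G : 'M[R]_d) (w : seq bool) : 'M[R]_d :=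
  foldr (fun b acc => (if b then F else G) *m acc) 1%:M w.

Definition famS (R : pzRingType) (d : nat) (k : nat) (F G : 'M[R]_d) (S : 'M[R]_d) : Prop :=
  exists w : seq bool, (1 <= size w <= k)%N /\ S = wordmx F G w.

Definition minor (R : comPzRingType) (d m : nat) (A : 'M[R]_d) (I J : {set 'I_d}) : R :=
  \det ((selmx R m I)^T *m A *m selmx R m J).

Definition allMinorsNZ (R : comPzRingType) (d : nat) (A : 'M[R]_d) : Prop :=
  forall (m : nat) (I J : {set 'I_d}), #|I| = m -> #|J| = m -> minor m A I J != 0.

Definition sqnorm (R : pzRingType) (d : nat) (v : 'cV[R]_d) : R := \sum_(k < d) v k 0 ^+ 2.

Definition distinctProducts (R : comPzRingType) (d : nat) (lam : 'I_d -> R) : Prop :=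
  forall (k : nat) (I J : {set 'I_d}), (1 <= k <= d)%N -> #|I| = k -> #|J| = k ->
    I != J -> \prod_(i in I) lam i != \prod_(i in J) lam i.

(* Main.v *)
Require Import Defs.
From HB Require Import structures.
From mathcomp Require Import all_boot all_order all_algebra all_fingroup.
From mathcomp Require Import ring zify.
Import Order.TTheory GRing.Theory Num.Theory.
Set Implicit Arguments. Unset Strict Implicit. Unset Printing Implicit Defensive.
Local Open Scope ring_scope.

(** By Cauchy-Binet, [<S V | W> = det (W^T S V)], and for [S = F^i G^b F^a G^j] this is
    an exponential sum [f_m (a, b) = sum_(J, I) y_J A_(J,I) x_I lam_I^a t_J^b] over pairs
    of [m]-sets, where [lam_I] and [t_J] are products of eigenvalues, [x] depends on [j]
    and [y] on [i].  Distinctness of the [lam_I] and of the [t_J] makes [f_m] nonzero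
    at some [(a, b)] with [1 <= a, b <= 'C(d, m)].

    For [C(s)] with [m < s < m + 1] one needs [f_m] and [f_(m+1)] nonzero at the same
    [(a, b)].  Since [lam_I = - lam_K] may occur, the two functions can vanish on
    complementary parity classes of [(a, b)], so words [G^b F^a] alone do not suffice.
    Choose [l] in [{m, m + 1}] with [2 l <> d].  Then some [l]-set [I0] has [|lam_I0|]
    different from all the other [|lam_I|]: otherwise both the maximal and the minimal
    [|lam_I|] are attained twice, which forces the unique pair of opposite eigenvalues
    to have [l - 1] eigenvalues above it and [l - 1] below it in absolute value.  The
    same holds for a set [J0] and [t].  As the minors of [A^-1] do not vanish either,
    some [i, j < 'C(d, l)] give [x_I0 <> 0] and [y_J0 <> 0]; then [f_l] is nonzero on
    every parity class.  On a parity class all bases are positive, so the product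
    [f_m f_(m+1)] does not vanish identically there.  This product involves at most
    [n0^2 - n0 + 1] distinct bases in each variable, which bounds [a] and [b]. *)

(** * The Cauchy-Binet formula *)

Section CauchyBinet.
Variable R : comPzRingType.
Implicit Types m d : nat.

Definition enum_fun d m (I : {set 'I_d}) (hI : #|I| = m) (j : 'I_m) : 'I_d :=
  enum_val (cast_ord (esym hI) j).

Lemma enum_fun_inj d m (I : {set 'I_d}) (hI : #|I| = m) : injective (enum_fun hI).
Proof. by move=> i j /enum_val_inj/cast_ord_inj. Qed.

Lemma enum_fun_onto d m (I : {set 'I_d}) (hI : #|I| = m) k :
  k \in I -> exists j, enum_fun hI j = k.
Proof.
move=> kI; exists (cast_ord hI (enum_rank_in kI k)).
by rewrite /enum_fun cast_ordK enum_rankK_in.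
Qed.

Lemma selmxE d m (I : {set 'I_d}) (hI : #|I| = m) k j :
  selmx R m I k j = (enum_fun hI j == k)%:R.
Proof.
rewrite mxE /enum_fun; congr ((_ == _)%:R).
by rewrite (enum_val_nth k).
Qed.

Lemma mul_selmx d m n (I : {set 'I_d}) (hI : #|I| = m) (A : 'M[R]_(n, d)) :
  A *m selmx R m I = \matrix_(i, j) A i (enum_fun hI j).
Proof.
apply/matrixP=> i j; rewrite !mxE (bigD1 (enum_fun hI j)) //= big1.
  by rewrite (selmxE hI) eqxx mulr1 addr0.
by move=> k kj; rewrite (selmxE hI) eq_sym (negPf kj) mulr0.
Qed.

Lemma mul_tr_selmx d m n (I : {set 'I_d}) (hI : #|I| = m) (B : 'M[R]_(d, n)) :
  (selmx R m I)^T *m B = \matrix_(i, j) B (enum_fun hI i) j.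
Proof.
apply: trmx_inj; rewrite trmx_mul trmxK (mul_selmx hI).
by apply/matrixP=> i j; rewrite !mxE.
Qed.

(** An injection with image [I] is the increasing enumeration of [I] after a permutation of ['I_m];
    this collects the terms of one minor in [cauchy_binet]. *)
Lemma sum_ffun_image (T : nmodType) d m (I : {set 'I_d}) (hI : #|I| = m)
    (Phi : {ffun 'I_m -> 'I_d} -> T) :
  \sum_(f : {ffun 'I_m -> 'I_d} | injectiveb f && (f @: setT == I)) Phi f =
  \sum_(s : 'S_m) Phi [ffun i => enum_fun hI (s i)].
Proof.
pose h (s : 'S_m) := [ffun i => enum_fun hI (s i)].
have h_inj : injective h.
  move=> s u /ffunP e; apply/permP=> i; move: (e i); rewrite !ffunE.
  exact: enum_fun_inj.
pose h' f : 'S_m := odflt 1%g [pick s | h s == f].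
have hK s : h' (h s) = s.
  rewrite /h'; case: pickP => [u /eqP/h_inj //|/(_ s)]; by rewrite eqxx.
rewrite (reindex_onto h h') /=.
  apply: eq_bigl => s; rewrite hK eqxx andbT; apply/andP; split.
    by apply/injectiveP=> i j; rewrite !ffunE => /enum_fun_inj/perm_inj.
  rewrite eqEcard; apply/andP; split.
    by apply/subsetP=> _ /imsetP[i _ ->]; rewrite ffunE; apply: enum_valP.
  rewrite card_imset ?cardsT ?card_ord ?hI //.
  by move=> i j; rewrite !ffunE => /enum_fun_inj/perm_inj.
move=> f /andP[/injectiveP f_inj /eqP imf].
have [g Hg] : exists g : {ffun 'I_m -> 'I_m}, forall i, enum_fun hI (g i) = f i.
  have ex i : {j | enum_fun hI j == f i}.
    apply: sigW; have /(enum_fun_onto hI)[j <-] : f i \in I.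
      by rewrite -imf imset_f.
    by exists j.
  by exists [ffun i => sval (ex i)] => i; rewrite ffunE; apply/eqP/(svalP (ex i)).
have g_inj : injective g by move=> i j e; apply: f_inj; rewrite -!Hg e.
have hf : h (perm g_inj) = f by apply/ffunP=> i; rewrite ffunE permE.
by rewrite -hf hK.
Qed.

Lemma det_rows_perm m d (B : 'M[R]_(d, m)) (e : 'I_m -> 'I_d) (s : 'S_m) :
  \det (\matrix_(i, j) B (e (s i)) j) = (-1) ^+ s * \det (\matrix_(i, j) B (e i) j).
Proof.
rewrite -det_perm -det_mulmx -row_permE; congr (\det _).
by apply/matrixP=> i j; rewrite !mxE.
Qed.

(** Multilinearity in the rows of [A *m B] gives a sum over all maps [f]. A non-injective [f]
    repeats a row of [B] and contributes 0; the injective ones are grouped by image. *)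
Lemma cauchy_binet m d (A : 'M[R]_(m, d)) (B : 'M[R]_(d, m)) :
  \det (A *m B) =
  \sum_(I : {set 'I_d} | #|I| == m)
     \det (A *m selmx R m I) * \det ((selmx R m I)^T *m B).
Proof.
transitivity (\sum_(f : {ffun 'I_m -> 'I_d})
   (\prod_i A i (f i)) * \det (\matrix_(i, j) B (f i) j)).
  transitivity (\sum_(s : 'S_m) \sum_(f : {ffun 'I_m -> 'I_d})
      (\prod_i A i (f i)) * ((-1) ^+ s * \prod_i B (f i) (s i))).
    apply: eq_bigr => s _.
    under eq_bigr do rewrite mxE.
    rewrite bigA_distr_bigA /= mulr_sumr; apply: eq_bigr => f _.
    by rewrite big_split /= mulrCA.
  rewrite exchange_big; apply: eq_bigr => f _ /=.
  rewrite -mulr_sumr; congr (_ * _); apply: eq_bigr => s _.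
  by congr (_ * _); apply: eq_bigr => i _; rewrite mxE.
rewrite (bigID (fun f : {ffun 'I_m -> 'I_d} => injectiveb f)) /= [X in _ + X]big1 ?addr0.
  rewrite (partition_big (fun f : {ffun 'I_m -> 'I_d} => f @: setT)
             (fun I : {set 'I_d} => #|I| == m)) /=; last first.
    by move=> f /injectiveP f_inj; rewrite card_imset // cardsT card_ord.
  apply: eq_bigr => I /eqP hI.
  rewrite (sum_ffun_image hI) (mul_selmx hI) (mul_tr_selmx hI) mulr_suml.
  apply: eq_bigr => s _.
  rewrite [in LHS](_ : \matrix_(i, j) _ = \matrix_(i, j) B (enum_fun hI (s i)) j).
    rewrite det_rows_perm mulrCA mulrA; congr (_ * _ * _).
    by apply: eq_bigr => i _; rewrite mxE ffunE.
  by apply/matrixP=> i j; rewrite !mxE ffunE.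
move=> f /injectivePn[i [j ij fij]].
rewrite (determinant_alternate ij) ?mulr0 // => k.
by rewrite !mxE fij.
Qed.

End CauchyBinet.

(** * Exponential sums *)

Section ExpSum.
Variable R : idomainType.

Lemma sum_partition_values (T : eqType) (S : nmodType) (r : seq T) (mu : T -> R) (f : T -> S) :
  \sum_(i <- r) f i = \sum_(x <- undup (map mu r)) \sum_(i <- r | mu i == x) f i.
Proof.
under [RHS]eq_bigr do rewrite big_mkcond.
rewrite exchange_big /= [LHS]big_seq [RHS]big_seq; apply: eq_bigr => i ir.
rewrite (bigD1_seq (mu i)) ?undup_uniq ?mem_undup ?map_f //= eqxx big1 ?addr0 // => x.
by rewrite eq_sym => /negPf->.
Qed.

Lemma expsum_level_neq0 (T : eqType) (r : seq T) (mu c : T -> R) a :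
  \sum_(i <- r) c i * mu i ^+ a != 0 ->
  exists2 v, v \in map mu r & \sum_(i <- r | mu i == v) c i != 0.
Proof.
rewrite (sum_partition_values _ mu) => nz.
have [/hasP[v] vr hv|/hasPn h] :=
  boolP (has (fun v => \sum_(i <- r | mu i == v) c i != 0) (undup (map mu r))).
  by exists v => //; rewrite -mem_undup.
case/eqP: nz; rewrite big_seq big1 // => v /h /negPn /eqP h0.
under eq_bigr => i /eqP-> do [].
by rewrite -mulr_suml h0 mul0r.
Qed.

(* Pair the sum with the polynomial vanishing at 0 and at every value of [mu] but [v]. *)
Lemma expsum_neq0 (T : eqType) (r : seq T) (mu c : T -> R) v :
  v != 0 -> \sum_(i <- r | mu i == v) c i != 0 ->
  exists2 a, (0 < a <= size (undup (map mu r)))%N & \sum_(i <- r) c i * mu i ^+ a != 0.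
Proof.
move=> v0 hv; set u := undup _.
have vu : v \in u.
  apply: contraNT hv => vu; rewrite big_seq_cond big1 // => i /andP[ir /eqP e].
  by rewrite -e mem_undup map_f in vu.
pose w := rem v u.
have uu : uniq u by apply: undup_uniq.
have sw : size w = (size u).-1 by rewrite size_rem.
have su : (0 < size u)%N by case: (u) vu.
pose p : {poly R} := 'X * \prod_(x <- w) ('X - x%:P).
have sp : size p = (size u).+1.
  rewrite /p mulrC size_mulX ?size_prod_XsubC ?sw ?prednK //.
  by apply: monic_neq0; apply: monic_prod_XsubC.
have p0 : p`_0 = 0 by rewrite /p mulrC coefMX.
have pv : p.[v] != 0.
  rewrite hornerM hornerX mulf_neq0 // -[_ == 0]/(root _ v) root_prod_XsubC.
  by rewrite mem_rem_uniqF.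
have px x : x \in u -> x != v -> p.[x] = 0.
  move=> xu xv; rewrite hornerM [X in _ * X](_ : _ = 0) ?mulr0 //.
  by apply/rootP; rewrite root_prod_XsubC mem_rem_uniq // inE xv.
have : \sum_(i <- r) c i * p.[mu i] != 0.
  rewrite (bigID (fun i => mu i == v)) /= [X in _ + X]big_seq_cond [X in _ + X]big1 ?addr0.
    by under eq_bigr => i /eqP-> do []; rewrite -mulr_suml mulf_neq0.
  by move=> i /andP[ir hi]; rewrite px ?mulr0 // mem_undup map_f.
(* As [p] has degree [size u] and constant term 0, some exponent from 1 to [size u] contributes. *)
under eq_bigr do rewrite horner_coef mulr_sumr.
rewrite exchange_big /= sp => nz.
have [/existsP[k /andP[k0 hk]]|/existsPn h] := boolP [exists k : 'I_(size u).+1,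
   (0 < k)%N && (\sum_(i <- r) c i * mu i ^+ k != 0)].
  by exists k => //; rewrite k0 -ltnS /=.
case/eqP: nz; rewrite big1 // => k _.
under eq_bigr do rewrite mulrCA.
rewrite -mulr_sumr; case: (posnP k) => [->|k0]; first by rewrite p0 mul0r.
by move: (h k); rewrite k0 /= negbK => /eqP->; rewrite mulr0.
Qed.

(** Trades an uncontrolled exponent for a bounded one: nonvanishing at [a] yields a base with
    nonzero total coefficient, a fact independent of [a]. *)
Lemma expsum_bounded (T : eqType) (r : seq T) (mu c : T -> R) a :
  {in r, forall i, mu i != 0} ->
  \sum_(i <- r) c i * mu i ^+ a != 0 ->
  exists2 b, (0 < b <= size (undup (map mu r)))%N & \sum_(i <- r) c i * mu i ^+ b != 0.
Proof.
move=> mu0 /expsum_level_neq0[v /mapP[i ir ->] hv]; exact: expsum_neq0 (mu0 _ ir) hv.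
Qed.

Lemma expsum_inj_neq0 (T : eqType) (r : seq T) (mu c : T -> R) i0 :
  uniq r -> i0 \in r -> {in r, forall i, i != i0 -> mu i != mu i0} ->
  mu i0 != 0 -> c i0 != 0 ->
  exists2 a, (0 < a <= size r)%N & \sum_(i <- r) c i * mu i ^+ a != 0.
Proof.
move=> ur i0r hi mu0 c0.
have [||a /andP[a0 ha] na] := @expsum_neq0 T r mu c (mu i0) => //.
  rewrite big_mkcond (bigD1_seq i0) //= eqxx big_seq_cond big1 ?addr0 //.
  by move=> i /andP[ir /(hi _ ir)/negPf->].
exists a => //; rewrite a0 (leq_trans ha) // (leq_trans (size_undup _)) //.
by rewrite size_map.
Qed.

End ExpSum.

(** Dividing each coefficient by its base shifts the exponent range down by one. The unit gained
    makes the final word length exactly [2 * n0 ^ 2]. *)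
Lemma expsum_inj_neq0_lt (R : fieldType) (T : eqType) (r : seq T) (mu c : T -> R) i0 :
  uniq r -> i0 \in r -> {in r, forall i, i != i0 -> mu i != mu i0} ->
  {in r, forall i, mu i != 0} -> c i0 != 0 ->
  exists2 a, (a < size r)%N & \sum_(i <- r) c i * mu i ^+ a != 0.
Proof.
move=> ur i0r mu_inj mu0 c0.
have [||[|a] // ha na] := @expsum_inj_neq0 _ _ r mu (fun i => c i / mu i) i0 ur i0r mu_inj.
- exact: mu0.
- by rewrite mulf_neq0 ?invr_eq0 ?mu0.
exists a => //; apply: contraNneq na => e; rewrite -[X in _ == X]e; apply/eqP.
rewrite [LHS]big_seq [RHS]big_seq; apply: eq_bigr => i ir.
by rewrite exprS mulrA divfK ?mu0.
Qed.

(** * Exponential sums with positive bases *)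

Section PosExpSum.
Variable R : realDomainType.

Lemma seq_max (s : seq R) x : x \in s -> exists2 y, y \in s & {in s, forall z, z <= y}.
Proof.
elim: s x => // a s IH x _; case: s IH => [_|b s IH].
  by exists a; rewrite ?mem_head // => z; rewrite inE => /eqP->.
have [y ys hy] := IH b (mem_head _ _).
have [ay|ya] := leP a y.
  exists y; first by rewrite inE ys orbT.
  by move=> z; rewrite inE => /predU1P[->|/hy].
exists a; first exact: mem_head.
move=> z; rewrite inE => /predU1P[->//|/hy h]; exact: le_trans h (ltW ya).
Qed.

(* The largest bases of the two sums multiply to the largest base of
   the product, which therefore cannot cancel. *)
Lemma pos_expsum_mul_neq0 (T1 T2 : eqType) (r1 : seq T1) (r2 : seq T2)
    (mu1 c1 : T1 -> R) (mu2 c2 : T2 -> R) p1 p2 :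
  {in r1, forall i, 0 < mu1 i} -> {in r2, forall i, 0 < mu2 i} ->
  \sum_(i <- r1) c1 i * mu1 i ^+ p1 != 0 -> \sum_(i <- r2) c2 i * mu2 i ^+ p2 != 0 ->
  exists p, \sum_(i <- r1) c1 i * mu1 i ^+ p != 0 /\ \sum_(i <- r2) c2 i * mu2 i ^+ p != 0.
Proof.
pose C (T : eqType) (r : seq T) (mu c : T -> R) x := \sum_(i <- r | mu i == x) c i.
(* The distinct bases whose total coefficient does not cancel. *)
pose sup (T : eqType) r mu c := [seq x <- undup (map mu r) | C T r mu c x != 0].
have expC (T : eqType) (r : seq T) (mu c : T -> R) p :
    \sum_(i <- r) c i * mu i ^+ p = \sum_(x <- sup T r mu c) C T r mu c x * x ^+ p.
  rewrite (sum_partition_values _ mu) /sup big_filter [RHS]big_mkcond /=.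
  apply: eq_bigr => x _; under eq_bigr => i /eqP-> do [].
  by rewrite -mulr_suml -/(C _ r mu c x); case: eqP => // ->; rewrite mul0r.
have key (T : eqType) (r : seq T) (mu c : T -> R) p :
    {in r, forall i, 0 < mu i} -> \sum_(i <- r) c i * mu i ^+ p != 0 ->
    exists v, [/\ v \in sup T r mu c, 0 < v & {in sup T r mu c, forall z, z <= v}].
  move=> pos /expsum_level_neq0[v vr hv].
  have vs : v \in sup T r mu c by rewrite mem_filter mem_undup vr andbT.
  have [y ys hy] := seq_max vs; exists y; split => //.
  by move: ys; rewrite mem_filter mem_undup => /andP[_ /mapP[i /pos h ->]].
move=> pos1 pos2 /(key _ _ _ _ _ pos1)[x0 [xs x0p xmax]] /(key _ _ _ _ _ pos2)[y0 [ys y0p ymax]].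
set s1 := sup _ _ _ _ in xs xmax; set s2 := sup _ _ _ _ in ys ymax.
set C1 := C _ r1 mu1 c1; set C2 := C _ r2 mu2 c2.
have [||p _] := @expsum_neq0 R _ [seq (x, y) | x <- s1, y <- s2]
   (fun z => z.1 * z.2) (fun z => C1 z.1 * C2 z.2) (x0 * y0).
- by rewrite mulf_neq0 ?gt_eqF.
(* Only the pair [(x0, y0)] reaches [x0 * y0]: [x < x0] gives a strictly smaller product, and
   [x = x0] forces [y = y0]. *)
- rewrite big_mkcond big_allpairs_dep /= (bigD1_seq x0) ?filter_uniq ?undup_uniq //=.
  rewrite (bigD1_seq y0) ?filter_uniq ?undup_uniq //= eqxx.
  rewrite [X in _ + X + _]big1 => [|y yy0]; last first.
    by case: eqP => // /(mulfI (lt0r_neq0 x0p)) /eqP; rewrite (negPf yy0).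
  rewrite [X in _ + X]big_seq_cond [X in _ + X]big1 ?addr0.
    move: xs ys; rewrite !mem_filter => /andP[h1 _] /andP[h2 _]; exact: mulf_neq0.
  move=> x /andP[xs1 xx0]; rewrite big_seq big1 // => y ys2; case: eqP => // e.
  have : x * y < x0 * y0.
    have xlt : x < x0 by rewrite lt_neqAle xx0 xmax.
    have xp : 0 < x.
      by move: xs1; rewrite mem_filter mem_undup => /andP[_ /mapP[i /pos1 h ->]].
    apply: (@le_lt_trans _ _ (x * y0)); first by rewrite ler_pM2l ?ymax.
    by rewrite ltr_pM2r.
  by rewrite e ltxx.
rewrite big_allpairs_dep /= => nz; exists p; rewrite (expC T1) (expC T2).
have e : \sum_(x <- s1) \sum_(y <- s2) C1 x * C2 y * (x * y) ^+ p =
    (\sum_(x <- s1) C1 x * x ^+ p) * (\sum_(y <- s2) C2 y * y ^+ p).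
  rewrite mulr_suml; apply: eq_bigr => x _.
  by rewrite mulr_sumr; apply: eq_bigr => y _; rewrite exprMn mulrACA.
by move: nz; rewrite e mulf_eq0 negb_or => /andP.
Qed.

End PosExpSum.

(** * Exponential sums in two exponents *)

Section ExpSum2.
Variables (R : realFieldType) (T : eqType).
Implicit Types (r : seq T) (lam t : T -> R) (c : T -> T -> R).

Definition expsum2 r lam t c a b :=
  \sum_(J <- r) \sum_(I <- r) c J I * lam I ^+ a * t J ^+ b.

Lemma expsum2_right r lam t c a b :
  expsum2 r lam t c a b = \sum_(J <- r) (\sum_(I <- r) c J I * lam I ^+ a) * t J ^+ b.
Proof. by apply: eq_bigr => J _; rewrite mulr_suml. Qed.

Lemma expsum2_left r lam t c a b :
  expsum2 r lam t c a b = \sum_(I <- r) (\sum_(J <- r) c J I * t J ^+ b) * lam I ^+ a.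
Proof.
rewrite /expsum2 exchange_big; apply: eq_bigr => I _; rewrite mulr_suml.
by apply: eq_bigr => J _; rewrite mulrAC.
Qed.

(* Advancing the exponents in steps of 2 keeps their parities and makes all the bases positive. *)
Lemma expsum2_common r1 r2 lam t c1 c2 I0 J0 a b :
  uniq r1 -> I0 \in r1 -> J0 \in r1 ->
  (forall I, I \in r1 ++ r2 -> lam I != 0) -> (forall I, I \in r1 ++ r2 -> t I != 0) ->
  {in r1, forall I, I != I0 -> lam I ^+ 2 != lam I0 ^+ 2} ->
  {in r1, forall J, J != J0 -> t J ^+ 2 != t J0 ^+ 2} ->
  c1 J0 I0 != 0 -> expsum2 r2 lam t c2 a b != 0 ->
  exists a' b', expsum2 r1 lam t c1 a' b' != 0 /\ expsum2 r2 lam t c2 a' b' != 0.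
Proof.
move=> ur1 I0r J0r lam0 t0 isoI isoJ c10 nz2.
have sq_gt0 (mu : T -> R) : (forall I, I \in r1 ++ r2 -> mu I != 0) ->
    {in r1, forall I, 0 < mu I ^+ 2} /\ {in r2, forall I, 0 < mu I ^+ 2}.
  by move=> mu0; split=> I Ir; rewrite exprn_even_gt0 //= mu0 // mem_cat Ir ?orbT.
have [l1 l2] := sq_gt0 _ lam0; have [t1 t2] := sq_gt0 _ t0.
have in1 I : I \in r1 -> I \in r1 ++ r2 by rewrite mem_cat => ->.
have shift (r : seq T) (mu d : T -> R) k n :
    \sum_(I <- r) d I * mu I ^+ (k + 2 * n) = \sum_(I <- r) d I * mu I ^+ k * (mu I ^+ 2) ^+ n.
  by apply: eq_bigr => I _; rewrite exprD exprM mulrA.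
(* Moving [b] first only makes the coefficient of the base [lam I0] in the first sum nonzero, thanks
   to the isolated [t J0 ^+ 2]. Moving [a] then makes that sum itself nonzero, thanks to the
   isolated [lam I0 ^+ 2]. *)
have [q [q1 q2]] : exists q, \sum_(J <- r1) c1 J I0 * t J ^+ (b + 2 * q) != 0 /\
    expsum2 r2 lam t c2 a (b + 2 * q) != 0.
  have [||q1 _ nq1] := @expsum_inj_neq0 _ _ r1 (fun J => t J ^+ 2)
     (fun J => c1 J I0 * t J ^+ b) J0 ur1 J0r isoJ.
  - by rewrite expf_neq0 ?t0 ?in1.
  - by rewrite mulf_neq0 ?expf_neq0 ?t0 ?in1.
  move: nz2; rewrite expsum2_right -[b in X in X -> _](addn0 b) -[in X in X -> _](muln0 2).
  rewrite shift => nz2.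
  have [q [h1 h2]] := pos_expsum_mul_neq0 t1 t2 nq1 nz2.
  by exists q; rewrite expsum2_right !shift.
have [p [p1 p2]] : exists p, expsum2 r1 lam t c1 (a + 2 * p) (b + 2 * q) != 0 /\
    expsum2 r2 lam t c2 (a + 2 * p) (b + 2 * q) != 0.
  have [||p1 _ np1] := @expsum_inj_neq0 _ _ r1 (fun I => lam I ^+ 2)
     (fun I => (\sum_(J <- r1) c1 J I * t J ^+ (b + 2 * q)) * lam I ^+ a) I0 ur1 I0r isoI.
  - by rewrite expf_neq0 ?lam0 ?in1.
  - by rewrite mulf_neq0 ?expf_neq0 ?lam0 ?in1.
  move: q2; rewrite expsum2_left -[a in X in X -> _](addn0 a) -[in X in X -> _](muln0 2).
  rewrite shift => q2.
  have [p [h1 h2]] := pos_expsum_mul_neq0 l1 l2 np1 q2.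
  by exists p; rewrite !expsum2_left !shift.
by exists (a + 2 * p)%N, (b + 2 * q)%N.
Qed.

(** The bases, in one exponent, of the product of two exponential sums over [r1] and [r2]. *)
Definition pair_values r1 r2 lam : seq R :=
  undup [seq lam z.1 * lam z.2 | z : T * T <- [seq (x, y) | x <- r1, y <- r2]].

Lemma expsum_mul_bounded r1 r2 lam (p1 p2 : T -> R) a :
  (forall I, I \in r1 ++ r2 -> lam I != 0) ->
  \sum_(I <- r1) p1 I * lam I ^+ a != 0 -> \sum_(I <- r2) p2 I * lam I ^+ a != 0 ->
  exists2 b, (0 < b <= size (pair_values r1 r2 lam))%N &
    \sum_(I <- r1) p1 I * lam I ^+ b != 0 /\ \sum_(I <- r2) p2 I * lam I ^+ b != 0.
Proof.
move=> lam0 n1 n2.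
have prodE k : \sum_(z <- [seq (x, y) | x <- r1, y <- r2])
      p1 z.1 * p2 z.2 * (lam z.1 * lam z.2) ^+ k =
    (\sum_(I <- r1) p1 I * lam I ^+ k) * (\sum_(I <- r2) p2 I * lam I ^+ k).
  rewrite big_allpairs_dep /= mulr_suml; apply: eq_bigr => I _.
  by rewrite mulr_sumr; apply: eq_bigr => K _; rewrite exprMn mulrACA.
have [||b hb] := @expsum_bounded _ _ [seq (x, y) | x <- r1, y <- r2]
  (fun z => lam z.1 * lam z.2) (fun z => p1 z.1 * p2 z.2) a.
- move=> _ /allpairsP[[I K] [/= Ir Kr ->]] /=.
  by rewrite mulf_neq0 ?lam0 // mem_cat ?Ir ?Kr ?orbT.
- by rewrite prodE mulf_neq0.
rewrite prodE mulf_eq0 negb_or => /andP[h1 h2].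
by exists b.
Qed.

(** One exponent at a time: with [b] fixed both sums are exponential sums in [a], and once [a] is
    reduced to [a'] they are exponential sums in [b]. *)
Lemma expsum2_common_bounded r1 r2 lam t c1 c2 a b :
  (forall I, I \in r1 ++ r2 -> lam I != 0) -> (forall I, I \in r1 ++ r2 -> t I != 0) ->
  expsum2 r1 lam t c1 a b != 0 -> expsum2 r2 lam t c2 a b != 0 ->
  exists a' b', [/\ (0 < a' <= size (pair_values r1 r2 lam))%N,
    (0 < b' <= size (pair_values r1 r2 t))%N,
    expsum2 r1 lam t c1 a' b' != 0 & expsum2 r2 lam t c2 a' b' != 0].
Proof.
move=> lam0 t0; rewrite !expsum2_left => n1 n2.
have [a' ha' []] := expsum_mul_bounded lam0 n1 n2.
rewrite -!expsum2_left !expsum2_right => {}n1 {}n2.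
have [b' hb' []] := expsum_mul_bounded t0 n1 n2.
by rewrite -!expsum2_right; exists a', b'.
Qed.

Lemma expsum2_inj_neq0 r lam t c I0 J0 :
  uniq r -> I0 \in r -> J0 \in r ->
  {in r, forall I, lam I != 0} -> {in r, forall I, t I != 0} ->
  {in r &, injective lam} -> {in r &, injective t} -> c J0 I0 != 0 ->
  exists a b, [/\ (0 < a <= size r)%N, (0 < b <= size r)%N & expsum2 r lam t c a b != 0].
Proof.
move=> ur I0r J0r lam0 t0 lam_inj t_inj c0.
have [||b hb nb] := @expsum_inj_neq0 _ _ r t (c^~ I0) J0 ur J0r _ _ c0.
- by move=> J Jr; apply: contra_neq; apply: t_inj.
- exact: t0.
have [||a ha na] := @expsum_inj_neq0 _ _ r lam
    (fun I => \sum_(J <- r) c J I * t J ^+ b) I0 ur I0r _ _ nb.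
- by move=> J Jr; apply: contra_neq; apply: lam_inj.
- exact: lam0.
by exists a, b; rewrite expsum2_left.
Qed.

End ExpSum2.

(** * Isolated products of eigenvalues *)

Section Isolated.
Variable R : realFieldType.

Lemma prod_swap d (s : 'I_d -> R) (I : {set 'I_d}) i k : i \in I -> k \notin I ->
  (\prod_(j in k |: I :\ i) s j) * s i = (\prod_(j in I) s j) * s k.
Proof.
move=> iI kI; have kIi : k \notin I :\ i by rewrite inE (negPf kI) andbF.
by rewrite big_setU1 //= (big_setD1 i iI) /=; ring.
Qed.

Lemma card_swap d (I : {set 'I_d}) i k : i \in I -> k \notin I -> #|k |: I :\ i| = #|I|.
Proof.
move=> iI kI; rewrite cardsU1 inE (negPf kI) andbF add1n (cardsD1 i I) iI.
by [].
Qed.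

(* Compare a maximal product with a second set reaching it: by exchange, the
   elements on which the two sets differ have equal weight, and this weight
   separates the maximal set from its complement. *)
Lemma isolated_or_tie d (s : 'I_d -> R) l :
  (forall i, 0 < s i) ->
  (forall i k j, i != k -> s i = s k -> s j = s i -> j = i \/ j = k) ->
  (l <= d)%N ->
  (exists2 I0 : {set 'I_d}, #|I0| = l & forall I : {set 'I_d}, #|I| = l -> I != I0 ->
       \prod_(i in I) s i != \prod_(i in I0) s i) \/
  (exists i k, [/\ i != k, s i = s k & #|[set j | s i < s j]|.+1 = l]).
Proof.
move=> s_gt0 tie ld.
pose P (I : {set 'I_d}) := \prod_(i in I) s i.
have P_gt0 I : 0 < P I by apply: prodr_gt0 => i _.
have [I1 cI1] : exists I1 : {set 'I_d}, #|I1| = l.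
  have : (0 < #|[set A : {set 'I_d} | #|A| == l]|)%N by rewrite card_draws card_ord bin_gt0.
  by case/card_gt0P=> I1; rewrite inE => /eqP; exists I1.
have [I0 /eqP cI0 maxI0] := @Order.TotalTheory.arg_maxP _ _ _ I1 (fun I : {set 'I_d} => #|I| == l) P
   (introT eqP cI1).
have swapP (I : {set 'I_d}) : #|I| = l -> P I = P I0 ->
    forall i k, i \in I -> k \notin I -> s k <= s i.
  move=> cI PI i k iI kI.
  have : P (k |: I :\ i) <= P I by rewrite PI; apply: maxI0; rewrite card_swap // cI.
  rewrite -(ler_pM2r (s_gt0 i)) prod_swap // -/(P I) ler_pM2l //.
have [/existsP[I /and3P[/eqP cI nI /eqP PI]]|/existsPn h] := boolP [exists I : {set 'I_d},
   [&& #|I| == l, I != I0 & P I == P I0]]; last first.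
  left; exists I0 => // I cI nI; apply/negP=> e.
  by move: (h I); rewrite cI eqxx nI /P e.
right.
have [i iI0 iI] : exists2 i, i \in I0 & i \notin I.
  by apply/subsetPn; apply: contra nI => sub; rewrite eq_sym eqEcard sub cI cI0 /=.
have [k kI kI0] : exists2 i, i \in I & i \notin I0.
  by apply/subsetPn; apply: contra nI => sub; rewrite eqEcard sub cI cI0 /=.
have e : s i = s k.
  by apply/eqP; rewrite eq_le (swapP I) ?(swapP I0).
have ik : i != k by apply: contraNneq kI0 => <-.
exists i, k; split => //.
(* Without [i], the set [I0] consists exactly of the elements strictly above the tie, since [tie]
   allows no third element of that weight. *)
rewrite -cI0 (cardsD1 i I0) iI0 add1n; congr (_.+1).
apply: eq_card => j; rewrite !inE; apply/idP/andP => [lt_ij|[ji jI0]].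
  split; first by apply: contraTneq lt_ij => ->; rewrite ltxx.
  by apply: contraTT lt_ij => jI0; rewrite -leNgt (swapP I0).
rewrite lt_neqAle; apply/andP; split; last by rewrite e (swapP I0).
apply/eqP=> /esym /(tie _ _ _ ik e)[ji'|jk]; first by rewrite ji' eqxx in ji.
by rewrite -jk jI0 in kI0.
Qed.

Lemma exists_isolated d (lam : 'I_d -> R) l :
  (forall i, lam i != 0) -> injective lam -> distinctProducts lam ->
  (l <= d)%N -> (2 * l != d)%N ->
  exists2 I0 : {set 'I_d}, #|I0| = l & forall I : {set 'I_d}, #|I| = l -> I != I0 ->
    (\prod_(i in I) lam i) ^+ 2 != (\prod_(i in I0) lam i) ^+ 2.
Proof.
move=> lam0 lam_inj dist ld nld.
pose s i := lam i ^+ 2.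
have s_gt0 i : 0 < s i by rewrite exprn_even_gt0 //= lam0.
have opp i k : i != k -> s i = s k -> lam k = - lam i.
  move=> ik /eqP; rewrite eqf_sqr => /orP[/eqP/lam_inj e|/eqP->]; last by rewrite opprK.
  by rewrite e eqxx in ik.
have tie i k j : i != k -> s i = s k -> s j = s i -> j = i \/ j = k.
  move=> ik e ej; have [->|ji] := eqVneq j i; first by left.
  by right; apply: lam_inj; rewrite (opp i k) // (opp i j) // eq_sym.
have [[I0 cI0 iso]|[i [k [ik e cgt]]]] := isolated_or_tie s_gt0 tie ld.
  by exists I0 => // I cI nI; rewrite -!prodrXl; apply: iso.
(* Inverse weights turn a minimal product into a maximal one, which yields a second tie, counted
   from below. *)
have sV_gt0 i' : 0 < (s i')^-1 by rewrite invr_gt0.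
have tieV i1 k1 j1 : i1 != k1 -> (s i1)^-1 = (s k1)^-1 -> (s j1)^-1 = (s i1)^-1 ->
    j1 = i1 \/ j1 = k1.
  by move=> n1 /invr_inj e1 /invr_inj e2; apply: tie.
have [[I0 cI0 iso]|[i' [k' [ik' /invr_inj e' clt]]]] := isolated_or_tie sV_gt0 tieV ld.
  by exists I0 => // I cI nI; rewrite -!prodrXl -(inj_eq invr_inj) -!prodfV; apply: iso.
have {clt} clt : #|[set j | s j < s i']|.+1 = l.
  by rewrite -clt; congr (_.+1); apply: eq_card => j; rewrite !inE ltf_pV2 ?qualifE /=.
(* Ties at two different weights would give [lam k * lam k' = lam i * lam i'], as both signs flip,
   against distinctness for pairs. *)
have ee : s i = s i'.
  apply/eqP/negPn/negP => ne.
  have ii' : i != i' by apply: contraNneq ne => ->.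
  have kk' : k != k' by apply: contraNneq ne => h; rewrite e e' h.
  have ik1 : i != k' by apply: contraNneq ne => h; rewrite e' h.
  have := dist 2 [set i; i'] [set k; k'] _ _ _ _.
  rewrite !cards2 ii' kk' !big_setU1 ?inE //= !big_set1 (opp i k) // (opp i' k') //.
  rewrite mulrNN eqxx => /(_ _ erefl erefl) h.
  suff : false by []. apply: h.
    by rewrite /=; move: (max_card [set i; i']); rewrite card_ord cards2 ii'.
  apply: contraNneq ik => /setP/(_ i); rewrite !inE eqxx /= (negPf ik1) orbF => /esym //.
(* The [l - 1] indices above the tie, the [l - 1] below it and the tied pair exhaust all [d]
   indices. *)
case/eqP: nld.
rewrite -ee in clt; move: cgt clt.
set A := [set j | s i < s j]; set B := [set j | s j < s i].
have AB : A :&: B = set0 by apply/setP=> j; rewrite !inE; case: ltgtP.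
have ABik : (A :|: B) :&: [set i; k] = set0.
  apply/setP=> j; rewrite !inE; apply/negP => /andP[h /orP[]/eqP ej];
    by move: h; rewrite ej -?e ltxx.
have full : A :|: B :|: [set i; k] = setT.
  apply/setP=> j; rewrite !inE; case: (ltgtP (s i) (s j)) => //= /esym /(tie _ _ _ ik e) h.
  by case: h => h; rewrite h eqxx ?orbT.
have := cardsUI (A :|: B) [set i; k]; have := cardsUI A B.
rewrite full AB ABik !cards0 cardsT card_ord cards2 ik /= => + + cgt clt; lia.
Qed.

End Isolated.

(** * Minors and exterior powers *)

Lemma prod_enum_fun (R : comPzSemiRingType) d m (I : {set 'I_d}) (hI : #|I| = m) (f : 'I_d -> R) :
  \prod_(j < m) f (enum_fun hI j) = \prod_(i in I) f i.
Proof.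
case: m / hI; rewrite [RHS]big_enum_val; apply: eq_bigr => j _.
by rewrite /enum_fun cast_ord_id.
Qed.

Lemma det_tr_selmx_diag (R : comPzRingType) d m (I : {set 'I_d}) (hI : #|I| = m) (u : 'rV[R]_d)
    (M : 'M[R]_(d, m)) :
  \det ((selmx R m I)^T *m (diag_mx u *m M)) =
  (\prod_(i in I) u 0 i) * \det ((selmx R m I)^T *m M).
Proof.
rewrite -(prod_enum_fun hI) !(mul_tr_selmx hI).
pose v : 'rV[R]_m := \row_j u 0 (enum_fun hI j).
rewrite (eq_bigr (fun j => v 0 j)) => [|j _]; last by rewrite mxE.
rewrite -det_diag -det_mulmx; congr (\det _); apply/matrixP=> i j.
by rewrite !mul_diag_mx !mxE.
Qed.

Section Jacobi.
Variable R : fieldType.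

Lemma row_selmx_compl d m (J : {set 'I_d}) (hJ : #|J| = m) n (hJC : #|~: J| = n) (x : 'rV[R]_d) :
  x *m selmx R m J = 0 -> x = x *m selmx R n (~: J) *m (selmx R n (~: J))^T.
Proof.
rewrite (mul_selmx hJ) => x0; apply/rowP=> k; rewrite mxE.
rewrite (eq_bigr (fun i => x 0 (enum_fun hJC i) * (enum_fun hJC i == k)%:R)); last first.
  by move=> i _; rewrite (mul_selmx hJC) mxE [X in _ * X]mxE (selmxE _ hJC).
have [kJ|] := boolP (k \in J).
  have [j ej] := enum_fun_onto hJ kJ.
  move/rowP/(_ j): x0; rewrite !mxE ej => ->; rewrite big1 // => i _.
  case: eqP => [e|_]; last by rewrite mulr0.
  have := enum_valP (cast_ord (esym hJC) i); rewrite -/(enum_fun hJC i) e.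
  by rewrite inE kJ.
rewrite -in_setC => kJ; have [j ej] := enum_fun_onto hJC kJ.
rewrite (bigD1 j) //= big1 => [|i ij]; first by rewrite ej eqxx mulr1 addr0.
by rewrite -ej (inj_eq (@enum_fun_inj _ _ _ hJC)) (negPf ij) mulr0.
Qed.

Lemma tr_selmx_mul d m n (I J : {set 'I_d}) (hI : #|I| = m) (hJ : #|J| = n) i j :
  ((selmx R m I)^T *m selmx R n J) i j = (enum_fun hI i == enum_fun hJ j)%:R.
Proof. by rewrite (mul_tr_selmx hI) mxE (selmxE _ hJ) eq_sym. Qed.

(* A kernel vector of a minor of the inverse extends to one of the complementary minor. *)
Lemma allMinorsNZ_inv d (A : 'M[R]_d) : A \in unitmx -> allMinorsNZ A -> allMinorsNZ (invmx A).
Proof.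
move=> uA nzA m I J hI hJ; apply/negP => /det0P[v v0 hv].
have hIC : #|~: I| = (d - m)%N by rewrite cardsCs setCK card_ord hI.
have hJC : #|~: J| = (d - m)%N by rewrite cardsCs setCK card_ord hJ.
have /negP := nzA _ _ _ hJC hIC; apply; apply/det0P.
(* [x] vanishes on [J] and [x *m A] is supported on [I], so the part of [x] on [~: J] is killed by
   the submatrix of [A] with rows [~: J] and columns [~: I]. *)
set x := v *m (selmx R m I)^T *m invmx A.
have xJ : x *m selmx R m J = 0 by rewrite -hv /x !mulmxA.
have xE := row_selmx_compl hJ hJC xJ.
exists (x *m selmx R (d - m) (~: J)).
  apply: contraNneq v0 => y0; rewrite y0 mul0mx in xE.
  have : v *m (selmx R m I)^T = 0 by rewrite -[LHS](mulmxKV uA) -/x xE mul0mx.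
  move/(congr1 (mulmx^~ (selmx R m I))); rewrite mul0mx -mulmxA.
  rewrite [_ *m selmx R m I](_ : _ = 1%:M) ?mulmx1 => [->//|].
  apply/matrixP=> i j; rewrite (tr_selmx_mul hI hI) !mxE.
  by rewrite (inj_eq (@enum_fun_inj _ _ _ hI)).
rewrite !mulmxA -xE /x mulmxKV // -mulmxA.
rewrite [_ *m selmx _ _ _](_ : _ = 0) ?mulmx0 //; apply/matrixP=> i j.
rewrite (tr_selmx_mul hI hIC) mxE; case: eqP => // e.
have := enum_valP (cast_ord (esym hIC) j); rewrite -/(enum_fun hIC j) -e inE.
by rewrite (enum_valP (cast_ord (esym hI) i)).
Qed.

End Jacobi.

Section Expansion.
Variable R : comPzRingType.

Definition powdiag d (u : 'I_d -> R) (a : nat) : 'M[R]_d := diag_mx (\row_i u i ^+ a).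

Definition sprod d (u : 'I_d -> R) (I : {set 'I_d}) : R := \prod_(i in I) u i.

Lemma det_tr_selmx_powdiag d m (I : {set 'I_d}) (hI : #|I| = m) u a (M : 'M[R]_(d, m)) :
  \det ((selmx R m I)^T *m (powdiag u a *m M)) = sprod u I ^+ a * \det ((selmx R m I)^T *m M).
Proof.
rewrite det_tr_selmx_diag //; congr (_ * _).
by rewrite /sprod -prodrXl; apply: eq_bigr => i _; rewrite mxE.
Qed.

Definition msets d m : seq {set 'I_d} := enum [set I : {set 'I_d} | #|I| == m].

Lemma mem_msets d m (I : {set 'I_d}) : (I \in msets d m) = (#|I| == m).
Proof. by rewrite mem_enum inE. Qed.

Lemma size_msets d m : size (msets d m) = 'C(d, m).
Proof. by rewrite -cardE card_draws card_ord. Qed.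

Lemma big_msets (T : nmodType) d m (f : {set 'I_d} -> T) :
  \sum_(I <- msets d m) f I = \sum_(I : {set 'I_d} | #|I| == m) f I.
Proof. by rewrite /msets big_enum /=; apply: eq_bigl => I; rewrite inE. Qed.

Lemma det_expand d m (B : 'M[R]_d) (u : 'I_d -> R) a (X : 'M[R]_(d, m))
    (J : {set 'I_d}) :
  #|J| = m ->
  \det ((selmx R m J)^T *m (B *m (powdiag u a *m X))) =
  \sum_(I <- msets d m) minor m B J I * \det ((selmx R m I)^T *m X) * sprod u I ^+ a.
Proof.
move=> hJ; rewrite big_msets (mulmxA _ B) cauchy_binet; apply: eq_bigr => I /eqP hI.
by rewrite det_tr_selmx_powdiag // mulrA mulrAC.
Qed.

Lemma ip_wedge d m (V W : 'M[R]_(d, m)) : ip (wedge V) (wedge W) = \det (W^T *m V).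
Proof.
rewrite cauchy_binet /ip [RHS]big_mkcond; apply: eq_bigr => I _; rewrite !ffunE.
case: ifP => _; last by rewrite mul0r.
by rewrite mulrC -[in RHS]det_tr trmx_mul trmxK.
Qed.

Lemma wedge_neq0P d m (V : 'M[R]_(d, m)) :
  wedge V != 0 -> exists2 I : {set 'I_d}, #|I| = m & \det ((selmx R m I)^T *m V) != 0.
Proof.
move=> nz; have [/existsP[I /andP[/eqP cI h]]|/existsPn h] := boolP [exists I : {set 'I_d},
  (#|I| == m) && (\det ((selmx R m I)^T *m V) != 0)]; first by exists I.
case/eqP: nz; apply/ffunP=> I; rewrite !ffunE; case: eqP => // /eqP cI.
by move: (h I); rewrite cI /= negbK => /eqP.
Qed.

(** By Cauchy-Binet the coordinates of [wedge (E *m V)] are combinations of those of [wedge V].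
    Taking for [E] the inverse of a map shows that the map preserves nonzero wedges. *)
Lemma wedge_neq0_lmul d m (E : 'M[R]_d) (V : 'M[R]_(d, m)) :
  wedge (E *m V) != 0 -> wedge V != 0.
Proof.
case/wedge_neq0P=> I cI; apply: contra_neq => V0; rewrite mulmxA cauchy_binet big1 // => J cJ.
by move/ffunP/(_ J): V0; rewrite !ffunE cJ => ->; rewrite mulr0.
Qed.

End Expansion.

(** * Words in F and G *)

(* When [m1 + m2 = d], the ['C(d, m1)] pairs [(I, ~: I)] all give the product of all the [u i]. *)
Lemma size_pair_values (R : realFieldType) d (u : 'I_d -> R) m1 m2 n0 :
  ('C(d, m1) <= n0)%N -> ('C(d, m2) <= n0)%N -> (m1 <= d)%N ->
  'C(d, m1) != 'C(d, m2) \/ (m1 + m2 = d)%N ->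
  (size (pair_values (msets d m1) (msets d m2) (sprod u)) + n0 <= n0 ^ 2 + 1)%N.
Proof.
move=> h1 h2 m1d [ne|m12].
  have : (size (pair_values (msets d m1) (msets d m2) (sprod u)) <= 'C(d, m1) * 'C(d, m2))%N.
    by rewrite (leq_trans (size_undup _)) // size_map size_allpairs !size_msets.
  (* Two different numbers bounded by [n0] have product at most [n0 * (n0 - 1)]. *)
  move: ne h1 h2; move: (size _) 'C(d, m1) 'C(d, m2) => s c1 c2; nia.
have e21 : 'C(d, m2) = 'C(d, m1) by rewrite -(bin_sub m1d) -m12 addKn.
set P := [seq (x, y) | x <- msets d m1, y <- msets d m2].
pose comp (z : {set 'I_d} * {set 'I_d}) := z.2 == ~: z.1.
have sP : size P = ('C(d, m1) * 'C(d, m1))%N by rewrite size_allpairs !size_msets e21.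
have cP : ('C(d, m1) <= count comp P)%N.
  rewrite -size_msets -(size_map (fun I : {set 'I_d} => (I, ~: I))) -size_filter.
  apply: uniq_leq_size => [|_ /mapP[I Im ->]].
    by rewrite map_inj_uniq ?enum_uniq // => I J [].
  rewrite mem_filter /comp eqxx /= allpairs_f //.
  by move: Im; rewrite !mem_msets => /eqP Im; rewrite cardsCs setCK card_ord Im -m12 addKn.
have : (size (pair_values (msets d m1) (msets d m2) (sprod u)) <=
        (count (predC comp) P).+1)%N.
  pose f (z : {set 'I_d} * {set 'I_d}) := sprod u z.1 * sprod u z.2.
  rewrite -size_filter -(size_map f) -[X in (_ <= X)%N]/(size (\prod_i u i :: _)).
  (* The extra head of the list is the common value of all complementary pairs. *)
  apply: uniq_leq_size (undup_uniq _) _ => x; rewrite mem_undup => /mapP[z zP ->].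
  rewrite inE; have [zc|nzc] := boolP (comp z); last first.
    by rewrite (map_f f) ?orbT // mem_filter zP andbT.
  rewrite (eqP zc) /sprod (bigID (mem z.1) predT) /=; apply/orP; left; apply/eqP.
  by congr (_ * _); apply: eq_bigl => i; rewrite inE.
have := count_predC comp P; rewrite sP.
have : ('C(d, m1) * 'C(d, m1) + n0 <= n0 ^ 2 + 'C(d, m1))%N.
  by rewrite -(subnKC h1); move: 'C(d, m1) (n0 - _)%N => c [|k]; nia.
by move: cP; lia.
Qed.

Section Words.
Variables (R : pzRingType) (d : nat) (F G : 'M[R]_d).

Lemma wordmx_cat w1 w2 : wordmx F G (w1 ++ w2) = wordmx F G w1 *m wordmx F G w2.
Proof. by elim: w1 => [|x w IH] /=; rewrite ?mul1mx // IH mulmxA. Qed.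

Lemma wordmx_nseq k x : wordmx F G (nseq k x) = (if x then F else G) ^+ k.
Proof. by elim: k => //= k ->; rewrite exprS. Qed.

Lemma famS_pow N i b a j : (0 < i + b + a + j <= N)%N ->
  famS N F G (F ^+ i *m G ^+ b *m F ^+ a *m G ^+ j).
Proof.
move=> h; exists (nseq i true ++ nseq b false ++ nseq a true ++ nseq j false).
by rewrite !size_cat !size_nseq !wordmx_cat !wordmx_nseq !mulmxA !addnA.
Qed.
End Words.

Lemma powdiagS (R : comPzRingType) d (u : 'I_d -> R) a :
  powdiag u a.+1 = powdiag u a *m powdiag u 1.
Proof.
rewrite /powdiag mul_diag_mx; apply/matrixP=> i j; rewrite !mxE.
by rewrite mulrnAr exprSr expr1.
Qed.

Lemma exp_eigenmx (R : comPzRingType) d (F E : 'M[R]_d) (u : 'I_d -> R) a :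
  F *m E = E *m powdiag u 1 -> F ^+ a *m E = E *m powdiag u a.
Proof.
move=> h; elim: a => [|a IH].
  rewrite expr0 mul1mx [powdiag u 0](_ : _ = 1%:M) ?mulmx1 //.
  by apply/matrixP=> i j; rewrite !mxE.
by rewrite exprSr -mulmxA h mulmxA IH -mulmxA -powdiagS.
Qed.

(** * Matrix coefficients of words as exponential sums *)

Section Main.
Variables (R : realFieldType) (d : nat) (F G EF EG A : 'M[R]_d) (lam t : 'I_d -> R).
Hypotheses (uF : F \in unitmx) (uG : G \in unitmx).
Hypotheses (uEF : EF \in unitmx) (uEG : EG \in unitmx) (uA : A \in unitmx).
Hypotheses (hF : F *m EF = EF *m powdiag lam 1) (hG : G *m EG = EG *m powdiag t 1).
Hypotheses (hA : EF = EG *m A) (nzA : allMinorsNZ A).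
Hypotheses (lam0 : forall i, lam i != 0) (t0 : forall i, t i != 0).
Hypotheses (lam_inj : injective lam) (t_inj : injective t).
Hypotheses (lam_dist : distinctProducts lam) (t_dist : distinctProducts t).

Lemma sprod_neq0 (u : 'I_d -> R) I : (forall i, u i != 0) -> sprod u I != 0.
Proof. by move=> u0; apply/prodf_neq0 => i _. Qed.

Lemma sprod_inj (u : 'I_d -> R) m : (m <= d)%N -> distinctProducts u ->
  {in msets d m &, injective (sprod u)}.
Proof.
move=> md du I J; rewrite !mem_msets => /eqP cI /eqP cJ e.
apply/eqP/negPn/negP => IJ; case: (posnP m) => [m0|m0].
  by move: IJ; rewrite (cards0_eq (etrans cI m0)) (cards0_eq (etrans cJ m0)) eqxx.
by move: (du m I J); rewrite m0 md => /(_ isT cI cJ IJ); rewrite -/(sprod u I) e eqxx.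
Qed.

(** The coordinate is an exponential sum in [j] with pairwise distinct bases; a nonzero coordinate
    of [X] times a nonzero minor of [B] gives a nonzero coefficient. *)
Lemma coord_neq0 (u : 'I_d -> R) m (B : 'M[R]_d) (X : 'M[R]_(d, m)) (J0 : {set 'I_d}) :
  (m <= d)%N -> (forall i, u i != 0) -> distinctProducts u -> #|J0| = m ->
  (forall I : {set 'I_d}, #|I| = m -> minor m B J0 I != 0) -> wedge X != 0 ->
  exists2 j, (j < 'C(d, m))%N &
    \det ((selmx R m J0)^T *m (B *m (powdiag u j *m X))) != 0.
Proof.
move=> md u0 du cJ0 hB /wedge_neq0P[I0 cI0 hI0].
have [||||j hj nj] := @expsum_inj_neq0_lt R _ (msets d m) (sprod u)
  (fun I => minor m B J0 I * \det ((selmx R m I)^T *m X)) I0 (enum_uniq _).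
- by rewrite mem_msets cI0.
- move=> I Im; apply: contra_neq; apply: (sprod_inj md du) => //.
  by rewrite mem_msets cI0.
- by move=> I _; apply: sprod_neq0.
- by rewrite mulf_neq0 ?hB.
by exists j; rewrite -?size_msets // det_expand.
Qed.

(* The Pluecker coordinates of [G ^+ j *m V] in the eigenbasis of [F], and those of
   [(F ^+ i)^T *m W] in the basis dual to the eigenbasis of [G]. *)
Definition xcoord m (V : 'M[R]_(d, m)) j (I : {set 'I_d}) :=
  \det ((selmx R m I)^T *m (invmx EF *m (G ^+ j *m V))).
Definition ycoord m (W : 'M[R]_(d, m)) i (J : {set 'I_d}) :=
  \det (W^T *m F ^+ i *m EG *m selmx R m J).
Definition wcoef m (V W : 'M[R]_(d, m)) i j (J I : {set 'I_d}) :=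
  ycoord W i J * minor m A J I * xcoord V j I.

(** In the two eigenbases the inner powers are diagonal, with [A] as the change of basis between
    them; Cauchy-Binet is applied at each diagonal factor. *)
Lemma det_word m (V W : 'M[R]_(d, m)) i b a j :
  \det (W^T *m (F ^+ i *m G ^+ b *m F ^+ a *m G ^+ j *m V)) =
  expsum2 (msets d m) (sprod lam) (sprod t) (wcoef V W i j) a b.
Proof.
have -> : F ^+ i *m G ^+ b *m F ^+ a *m G ^+ j *m V =
  F ^+ i *m EG *m (powdiag t b *m (A *m (powdiag lam a *m (invmx EF *m (G ^+ j *m V))))).
  rewrite !mulmxA -[F ^+ i *m EG *m _]mulmxA -(exp_eigenmx b hG) !mulmxA.
  rewrite -[_ *m EG *m A]mulmxA -hA -[_ *m EF *m _]mulmxA -(exp_eigenmx a hF) !mulmxA.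
  by rewrite (mulmxK uEF).
rewrite !(mulmxA W^T) cauchy_binet /expsum2 big_msets; apply: eq_bigr => J /eqP cJ.
rewrite det_tr_selmx_powdiag // det_expand // mulrA mulr_sumr; apply: eq_bigr => I _.
by rewrite /wcoef /ycoord /xcoord; ring.
Qed.

(** [G ^+ j] is diagonal in its own eigenbasis, and [invmx A] leads from there to the eigenbasis of
    [F]; hence the need for the minors of the inverse. *)
Lemma xcoord_neq0 m (V : 'M[R]_(d, m)) (I0 : {set 'I_d}) :
  (m <= d)%N -> #|I0| = m -> wedge V != 0 -> exists2 j, (j < 'C(d, m))%N & xcoord V j I0 != 0.
Proof.
move=> md cI0 V0.
have [||j hj nj] := @coord_neq0 t m (invmx A) (invmx EG *m V) I0 md t0 t_dist cI0.
- by move=> J cJ; apply: allMinorsNZ_inv.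
- by apply: (@wedge_neq0_lmul _ _ _ EG); rewrite mulKVmx.
exists j => //; apply: contraNneq nj; rewrite /xcoord => <-; apply/eqP; congr (\det (_ *m _)).
rewrite !mulmxA; congr (_ *m _).
have -> : invmx A = invmx EF *m EG by rewrite -[LHS](mulKmx uEF) hA mulmxK.
by rewrite -[_ *m EG *m _]mulmxA -(exp_eigenmx j hG) -!mulmxA mulmxV ?mulmx1.
Qed.

Lemma ycoordE m (W : 'M[R]_(d, m)) i (J : {set 'I_d}) :
  ycoord W i J = \det ((selmx R m J)^T *m ((F ^+ i *m EG)^T *m W)).
Proof. by rewrite /ycoord -det_tr !trmx_mul trmxK !mulmxA. Qed.

Lemma ycoord_neq0 m (W : 'M[R]_(d, m)) (J0 : {set 'I_d}) :
  (m <= d)%N -> #|J0| = m -> wedge W != 0 -> exists2 i, (i < 'C(d, m))%N & ycoord W i J0 != 0.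
Proof.
move=> md cJ0 W0.
have [||i hi ni] := @coord_neq0 lam m (invmx A)^T (EF^T *m W) J0 md lam0 lam_dist cJ0.
- move=> J cJ; rewrite /minor -det_tr !trmx_mul !trmxK mulmxA.
  exact: allMinorsNZ_inv.
- by apply: (@wedge_neq0_lmul _ _ _ (invmx EF^T)); rewrite mulKmx ?unitmx_tr.
exists i => //; apply: contraNneq ni; rewrite ycoordE => <-; apply/eqP; congr (\det (_ *m _)).
rewrite !mulmxA; congr (_ *m _).
have -> : F ^+ i *m EG = EF *m powdiag lam i *m invmx A.
  by rewrite -(exp_eigenmx i hF) hA -!mulmxA mulmxV ?mulmx1.
by rewrite !trmx_mul [(powdiag lam i)^T]tr_diag_mx mulmxA.
Qed.

Lemma unitmx_exp (M : 'M[R]_d) k : M \in unitmx -> M ^+ k \in unitmx.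
Proof.
move=> uM; elim: k => [|k IH]; first by rewrite expr0 unitmx1.
by rewrite exprS unitmx_mul uM.
Qed.

(** No control on [i], [j] is needed to get some nonzero coefficient, because invertible maps keep
    the wedges nonzero. So [i] and [j] remain free to suit the other degree. *)
Lemma exists_wcoef_neq0 m (V W : 'M[R]_(d, m)) i j : wedge V != 0 -> wedge W != 0 ->
  exists I J : {set 'I_d}, [/\ #|I| = m, #|J| = m & wcoef V W i j J I != 0].
Proof.
move=> V0 W0.
have [|I cI hI] := @wedge_neq0P _ _ _ (invmx EF *m (G ^+ j *m V)).
  apply: (@wedge_neq0_lmul _ _ _ (invmx (G ^+ j) *m EF)).
  by rewrite -!mulmxA mulKVmx // mulKmx // unitmx_exp.
have [|J cJ hJ] := @wedge_neq0P _ _ _ ((F ^+ i *m EG)^T *m W).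
  apply: (@wedge_neq0_lmul _ _ _ (invmx (F ^+ i *m EG)^T)).
  by rewrite mulKmx // unitmx_tr unitmx_mul uEG unitmx_exp.
exists I, J; split => //; rewrite /wcoef ycoordE mulf_neq0 // mulf_neq0 //.
exact: nzA.
Qed.

Lemma exists_expsum2_neq0 m (V W : 'M[R]_(d, m)) i j : (m <= d)%N ->
  wedge V != 0 -> wedge W != 0 ->
  exists a b, [/\ (0 < a <= 'C(d, m))%N, (0 < b <= 'C(d, m))%N &
    expsum2 (msets d m) (sprod lam) (sprod t) (wcoef V W i j) a b != 0].
Proof.
move=> md V0 W0; have [I [J [cI cJ nz]]] := exists_wcoef_neq0 i j V0 W0.
rewrite -size_msets; apply: (expsum2_inj_neq0 _ _ _ _ _ _ _ nz).
- exact: enum_uniq.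
- by rewrite mem_msets cI.
- by rewrite mem_msets cJ.
- by move=> K _; apply: sprod_neq0.
- by move=> K _; apply: sprod_neq0.
- exact: sprod_inj.
- exact: sprod_inj.
Qed.

Variable n0 : nat.
Hypothesis hn0 : forall m, (m <= d)%N -> ('C(d, m) <= n0)%N.

(** [m1] is the degree with isolated sets and dictates [i] and [j]; for [m2] a single nonzero value
    of its sum suffices. Common exponents are found first and bounded afterwards. *)
Lemma exists_word_neq0 m1 m2 (V1 W1 : 'M[R]_(d, m1)) (V2 W2 : 'M[R]_(d, m2)) :
  (m1 <= d)%N -> (m2 <= d)%N -> (2 * m1 != d)%N ->
  'C(d, m1) != 'C(d, m2) \/ (m1 + m2 = d)%N ->
  wedge V1 != 0 -> wedge W1 != 0 -> wedge V2 != 0 -> wedge W2 != 0 ->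
  exists S, [/\ famS (2 * n0 ^ 2) F G S, \det (W1^T *m (S *m V1)) != 0 &
    \det (W2^T *m (S *m V2)) != 0].
Proof.
move=> m1d m2d m1h m12 V10 W10 V20 W20.
have [I0 cI0 isoI] := exists_isolated lam0 lam_inj lam_dist m1d m1h.
have [J0 cJ0 isoJ] := exists_isolated t0 t_inj t_dist m1d m1h.
have [j hj xj] := xcoord_neq0 m1d cI0 V10.
have [i hi yi] := ycoord_neq0 m1d cJ0 W10.
have [a0 [b0 [_ _ nz2]]] := exists_expsum2_neq0 i j m2d V20 W20.
have c0 : wcoef V1 W1 i j J0 I0 != 0.
  by rewrite /wcoef mulf_neq0 // mulf_neq0 //; apply: nzA.
have l0 I : I \in msets d m1 ++ msets d m2 -> sprod lam I != 0.
  by move=> _; apply: sprod_neq0.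
have tt0 I : I \in msets d m1 ++ msets d m2 -> sprod t I != 0.
  by move=> _; apply: sprod_neq0.
have [|||||a1 [b1 [n1 n2]]] := expsum2_common _ _ _ l0 tt0 _ _ c0 nz2.
- exact: enum_uniq.
- by rewrite mem_msets cI0.
- by rewrite mem_msets cJ0.
- by move=> I; rewrite mem_msets => /eqP cI; apply: isoI.
- by move=> I; rewrite mem_msets => /eqP cI; apply: isoJ.
have [a [b [/andP[a_gt0 ha] /andP[b_gt0 hb] {}n1 {}n2]]] := expsum2_common_bounded l0 tt0 n1 n2.
have Na := size_pair_values lam (hn0 m1d) (hn0 m2d) m1d m12.
have Nb := size_pair_values t (hn0 m1d) (hn0 m2d) m1d m12.
have hC := hn0 m1d.
exists (F ^+ i *m G ^+ b *m F ^+ a *m G ^+ j); split; last 2 first.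
- by rewrite det_word.
- by rewrite det_word.
(* The length is at most [2 * (n0 - 1) + 2 * (n0 ^ 2 - n0 + 1) = 2 * n0 ^ 2]. *)
apply: famS_pow; rewrite addn_gt0 addn_gt0 a_gt0 orbT /=.
move: Na Nb ha hb hi hj hC; clear.
move: (size _) (size _) 'C(d, m1) (n0 ^ 2)%N => Na Nb c q; lia.
Qed.

End Main.

(** * Eigenbases and the conclusion *)

Lemma eigenval_neq0 (R : fieldType) d (F : 'M[R]_d) (v : 'cV[R]_d) (x : R) :
  F \in unitmx -> v != 0 -> F *m v = x *: v -> x != 0.
Proof.
move=> uF v0 e; apply: contraNneq v0 => x0.
by rewrite -(mulKmx uF v) e x0 scale0r mulmx0.
Qed.

(** Applying [F ^+ a] to a linear relation between the eigenvectors gives, in each coordinate, an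
    exponential sum vanishing for all [a], against [expsum_inj_neq0]. *)
Lemma eigenmx_unit (R : fieldType) d (F E : 'M[R]_d) (u : 'I_d -> R) :
  injective u -> (forall i, u i != 0) -> (forall i, col i E != 0) ->
  F *m E = E *m powdiag u 1 -> E \in unitmx.
Proof.
move=> u_inj u0 E0 h; rewrite -unitmx_tr unitmxE unitfE; apply/negP => /det0P[v v0 hv].
have {hv} Ev : E *m v^T = 0 by apply: trmx_inj; rewrite trmx_mul trmxK hv trmx0.
case/rV0Pn: v0 => i vi.
have /cV0Pn[k Eki] : col i E != 0 by [].
rewrite mxE in Eki.
have [|||||a _] := @expsum_inj_neq0 _ _ (index_enum 'I_d) u (fun j => E k j * v 0 j) i.
- exact: index_enum_uniq.
- exact: mem_index_enum.
- by move=> j _; apply: contra_neq; apply: u_inj.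
- exact: u0.
- by rewrite mulf_neq0.
case/negP; have : F ^+ a *m E *m v^T = 0 by rewrite -mulmxA Ev mulmx0.
rewrite (exp_eigenmx a h) -mulmxA [powdiag u a *m _]mul_diag_mx.
move=> /colP/(_ k); rewrite [X in _ = X -> _]mxE [X in X = _ -> _]mxE => e.
rewrite -[X in _ == X]e; apply/eqP; apply: eq_bigr => j _.
by rewrite !mxE -mulrA [v 0 j * _]mulrC.
Qed.

(** From [(m + 1) * 'C(d, m + 1) = (d - m) * 'C(d, m)]: equal binomials force [m + 1 = d - m]. *)
Lemma bin_succ_neq d m : (m < d)%N -> 'C(d, m) != 'C(d, m + 1) \/ (m + (m + 1) = d)%N.
Proof.
move=> md; case: eqP => [e|]; last by left.
right; have := mul_bin_left d m; rewrite -addn1 -e => /eqP.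
by rewrite eqn_pmul2r ?bin_gt0 1?ltnW // => /eqP; lia.
Qed.

Theorem mainTheorem6 (R : realFieldType) (d : nat) (F G : 'M[R]_d)
  (lam t : 'I_d -> R) (eF eG : 'I_d -> 'cV[R]_d) (A : 'M[R]_d) :
  F \in unitmx -> G \in unitmx ->
  injective lam -> injective t ->
  (forall i, F *m eF i = lam i *: eF i) -> (forall i, sqnorm (eF i) = 1) ->
  (forall i, G *m eG i = t i *: eG i) -> (forall i, sqnorm (eG i) = 1) ->
  distinctProducts lam -> distinctProducts t ->
  (forall i, eF i = \sum_(j < d) A j i *: eG j) ->
  allMinorsNZ A ->
  let n0 := (\max_(m < d.+1) 'C(d, m))%N in
  forall s : R, 0 <= s <= d%:R -> condC (famS (2 * n0 ^ 2) F G) s.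
Proof.
move=> uF uG lam_inj t_inj hF nF hG nG lam_dist t_dist hA nzA n0 s /andP[_ sd].
have hn0 m : (m <= d)%N -> ('C(d, m) <= n0)%N.
  by move=> md; apply: (leq_bigmax (Ordinal (md : (m < d.+1)%N))).
pose mat (e : 'I_d -> 'cV[R]_d) : 'M[R]_d := \matrix_(k, i) e i k 0.
have col_mat e i : col i (mat e) = e i by apply/colP=> k; rewrite !mxE.
have nz (e : 'I_d -> 'cV[R]_d) : (forall i, sqnorm (e i) = 1) -> forall i, e i != 0.
  move=> ne i; apply/eqP => e0; move: (ne i); rewrite /sqnorm e0 big1 => [/eqP|k _].
    by rewrite eq_sym oner_eq0.
  by rewrite mxE expr0n.
have eig (M : 'M[R]_d) (e : 'I_d -> 'cV[R]_d) u :
    (forall i, M *m e i = u i *: e i) -> M *m mat e = mat e *m powdiag u 1.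
  move=> h; apply/matrixP=> k i; rewrite [powdiag _ _]/(diag_mx _) mul_mx_diag !mxE expr1 mulrC.
  have /colP/(_ k) := h i; rewrite !mxE => <-.
  by apply: eq_bigr => j _; rewrite mxE.
have lam0 i : lam i != 0 by apply: eigenval_neq0 (nz _ nF i) (hF i).
have t0 i : t i != 0 by apply: eigenval_neq0 (nz _ nG i) (hG i).
have EF := eig _ _ _ hF; have EG := eig _ _ _ hG.
have uEF : mat eF \in unitmx.
  by apply: eigenmx_unit lam_inj lam0 _ EF => i; rewrite col_mat nz.
have uEG : mat eG \in unitmx.
  by apply: eigenmx_unit t_inj t0 _ EG => i; rewrite col_mat nz.
have EA : mat eF = mat eG *m A.
  apply/matrixP=> k i; rewrite !mxE hA summxE; apply: eq_bigr => j _.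
  by rewrite !mxE mulrC.
have uA : A \in unitmx by move: uEF; rewrite EA unitmx_mul => /andP[].
split=> [m sm|m /andP[ms _]].
  have md : (m <= d)%N by rewrite -(ler_nat R) -sm.
  move=> V W V0 W0.
  have [a [b [ha hb nzab]]] :=
    exists_expsum2_neq0 uF uG uEF uEG nzA lam0 t0 lam_dist t_dist 0 0 md V0 W0.
  (* A single degree needs no outer powers: the word [G ^+ b *m F ^+ a] has length at most
     [2 * n0]. *)
  exists (F ^+ 0 *m G ^+ b *m F ^+ a *m G ^+ 0); split.
    apply: famS_pow; have := hn0 _ md; nia.
  by rewrite ip_wedge (det_word uEF EF EG EA).
have md : (m < d)%N by rewrite -(ltr_nat R) (lt_le_trans ms).
have md' : (m + 1 <= d)%N by rewrite addn1.
move=> V W v w V0 W0 Vv0 Ww0.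
have two := exists_word_neq0 uF uG uEF uEG uA EF EG EA nzA lam0 t0 lam_inj t_inj lam_dist t_dist hn0.
(* If [2 * m = d], degree [m + 1] takes the role of the degree with isolated sets. *)
have [e|ne] := eqVneq (2 * m)%N d.
  have [||S [PS h1 h2]] := two _ _ _ _ _ _ md' (ltnW md) _ _ Vv0 Ww0 V0 W0.
  - by rewrite -e; lia.
  - by case: (bin_succ_neq md) => h; [left; rewrite eq_sym | right; rewrite addnC].
  by exists S; rewrite !ip_wedge.
have [S [PS h1 h2]] := two _ _ _ _ _ _ (ltnW md) md' ne (bin_succ_neq md) V0 W0 Vv0 Ww0.
by exists S; rewrite !ip_wedge.
Qed.
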